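(* Let $q$ be a prime power and let $(u_n)_{n\ge 0}$ be a $q$-automatic sequence over $\mathbb{F}_q$ which is not ultimately periodic, with generating function $G(t)=\sum_{n\ge 0}u_nt^n\in\mathbb{F}_q[[t]]$. Let $h(s,t)=h_0(t)+h_1(t)s+\dots+h_d(t)s^d\in\mathbb{F}_q[s,t]$ be a non-zero polynomial (with $h_i\in\mathbb{F}_q[t]$) such that $h(G(t),t)=0$ and such that $h(s,t)$, viewed as a polynomial in $s$, has no zero $s\in\mathbb{F}_q(t)$. Put $$M=\max_{0\le i\le d}\{\deg h_i-i\}.$$ Then for every $N\ge 1$, $$\frac{N-M}{d}\le L(u_n,N)\le \frac{(d-1)N+M+1}{d}.$$
   Context: A sequence $(u_n)$ over an alphabet is $k$-automatic if it is the output sequence of a finite automaton whose input is the $k$-ary digital expansion of $n$ (equivalently, for $k=q$ a prime power and alphabet $\mathbb{F}_q$, its generating function is algebraic over $\mathbb{F}_q(t)$). A sequence is ultimately periodic if it is periodic from some index on. The $N$th linear complexity $L(u_n,N)$ is the least $L\ge 0$ such that there exist $c_0,\dots,c_{L-1}\in\mathbb{F}_q$ with $u_{n+L}=c_{L-1}u_{n+L-1}+\dots+c_0u_n$ for all $0\le n\le N-L-1$; by convention $L(u_n,N)=0$ if $u_0=\dots=u_{N-1}=0$, and $L(u_n,N)=N$ if $u_0=\dots=u_{N-2}=0\ne u_{N-1}$. *)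

(* Defs.v *)
From HB Require Import structures.
From mathcomp Require Import all_boot all_order all_algebra all_field.

Set Implicit Arguments.
Unset Strict Implicit.
Unset Printing Implicit Defensive.

Import Order.TTheory GRing.Theory Num.Theory.

Local Open Scope ring_scope.

Record dfao (k : nat) (A : Type) := Dfao {
  dfao_state : finType;
  dfao_init : dfao_state;
  dfao_trans : dfao_state -> 'I_k -> dfao_state;
  dfao_out : dfao_state -> A }.

Definition dfao_run (k : nat) (A : Type) (M : dfao k A) (w : seq 'I_k) : A :=
  dfao_out (foldl (@dfao_trans k A M) (dfao_init M) w).

(* The k-ary digital expansion of n: most significant digit first and without
   leading zeros, so that 0 is expanded as the empty word. *)
Definition is_expansion (k n : nat) (w : seq 'I_k) : Prop :=
  foldl (fun (m : nat) (a : 'I_k) => (m * k + a)%N) 0%N w = n /\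
  (if w is a :: _ then (a : nat) != 0%N else true).

Definition automatic (k : nat) (A : Type) (u : nat -> A) : Prop :=
  exists M : dfao k A,
    forall (n : nat) (w : seq 'I_k), is_expansion n w -> u n = dfao_run M w.

Definition ultimately_periodic (A : Type) (u : nat -> A) : Prop :=
  exists n0 T : nat, (0 < T)%N /\ forall n, (n0 <= n)%N -> u (n + T)%N = u n.

Section LinearComplexity.

Variables (F : finFieldType) (u : nat -> F).

(* For L <= N the bound n < N - L is the range 0 <= n <= N - L - 1. *)
Definition lin_rec (N L : nat) : bool :=
  [exists c : {ffun 'I_L -> F}, [forall n : 'I_(N - L),
    u (n + L)%N == \sum_(i < L) c i * u (n + i)%N]].

Lemma lin_rec_ex (N : nat) : exists L, lin_rec N L.
Proof.
exists N; apply/existsP; exists [ffun=> 0]; apply/forallP => -[n /=].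
by rewrite subnn.
Qed.

Definition lin_complexity (N : nat) : nat := ex_minn (lin_rec_ex N).

(* The two conventional values of the linear complexity need no separate
   clause: for L = 0 the sum is empty, and for L = N no equation is left. *)
Lemma lin_complexity_eq0 (N : nat) :
  (forall n, (n < N)%N -> u n = 0) -> lin_complexity N = 0%N.
Proof.
move=> u0; rewrite /lin_complexity; case: ex_minnP => L _ minL.
apply/eqP; rewrite -leqn0; apply: minL.
apply/existsP; exists [ffun=> 0]; apply/forallP => n.
by rewrite big_ord0 addn0 u0 // (leq_trans (ltn_ord n)) ?leq_subr.
Qed.

Lemma lin_complexity_eqN (N : nat) :
  (forall n, (n < N)%N -> u n = 0) -> u N != 0 -> lin_complexity N.+1 = N.+1.
Proof.
move=> u0 uN; rewrite /lin_complexity; case: ex_minnP => L recL minL.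
have leLN : (L <= N.+1)%N.
  apply: minL; apply/existsP; exists [ffun=> 0].
  by apply/forallP => -[n /=]; rewrite subnn.
apply/eqP; rewrite eqn_leq leLN leqNgt; apply/negP => ltLN.
have lt_n : (N - L < N.+1 - L)%N by rewrite subSn.
case/existsP: recL => c /forallP/(_ (Ordinal lt_n)) /=.
rewrite subnK // big1 ?(negPf uN) // => i _.
by rewrite u0 ?mulr0 // -{2}(subnK (ltLN : (L <= N)%N)) ltn_add2l.
Qed.

End LinearComplexity.

(* A formal power series in t is its sequence of coefficients; in particular a
   sequence u is its own generating function. *)
Definition fps (R : Type) : Type := nat -> R.

Section PowerSeries.

Variable R : nzRingType.

Definition fps_of_poly (p : {poly R}) : fps R := fun n => p`_n.

Definition fps_mul (a b : fps R) : fps R :=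
  fun n => \sum_(i < n.+1) a i * b (n - i)%N.

Definition fps_exp (a : fps R) (m : nat) : fps R :=
  iter m (fps_mul a) (fps_of_poly 1).

(* The series h(G(t), t); the outer variable of h is s, the inner one is t. *)
Definition fps_eval (h : {poly {poly R}}) (G : fps R) : fps R :=
  fun n => \sum_(i < size h) fps_mul (fps_of_poly h`_i) (fps_exp G i) n.

Definition gen_fun (u : nat -> R) : fps R := u.

(* M is the maximum of deg h_i - i over 0 <= i <= d; as deg 0 = -oo, the
   indices with h_i = 0 do not contribute. *)
Definition is_max_deg_sub (h : {poly {poly R}}) (d : nat) (M : int) : Prop :=
  (exists2 i : nat, (i <= d)%N && (h`_i != 0) &
     M = (size h`_i).-1%:Z - i%:Z) /\
  (forall i : nat, (i <= d)%N -> h`_i != 0 -> (size h`_i).-1%:Z - i%:Z <= M).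

End PowerSeries.

(* Main.v *)
(** If [L] satisfies the recurrence condition for [N], then [G] agrees modulo [t^N]
    with a fraction [P / Q], where [deg P < L], [deg Q <= L] and [Q(0) = 1]. As [h]
    has no rational zero, [Q^d h(P / Q, t)] is a non-zero polynomial; it is divisible
    by [t^N] and has degree at most [d L + M], whence [N <= d L + M].

    For the upper bound, the recurrence of length [L] is a linear system whose
    matrix is the [(N - L) x L] Hankel matrix of [u]. If its rows are independent,
    the system is solvable. Otherwise a dependence between the rows, with last
    non-zero coefficient at [m < N - L], is a recurrence of length [m] for the first
    [m + L] terms, so that [m + L <= d m + M] by the lower bound; this fails as soon
    as [d L > (d - 1) (N - 1) + M]. *)

Require Import Defs.
From HB Require Import structures.
From mathcomp Require Import all_boot all_order all_algebra all_field.
From mathcomp Require Import zify ring.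

Set Implicit Arguments.
Unset Strict Implicit.
Unset Printing Implicit Defensive.

Import Order.TTheory GRing.Theory Num.Theory.

Local Open Scope ring_scope.

Section Truncation.

Variable R : nzRingType.

Definition fps_agree (N : nat) (a : fps R) (p : {poly R}) : Prop :=
  forall n, (n < N)%N -> a n = p`_n.

Lemma fps_agree_mul N a b p q :
  fps_agree N a p -> fps_agree N b q -> fps_agree N (fps_mul a b) (p * q).
Proof.
move=> ap bq n ltnN; rewrite coefM; apply: eq_bigr => i _.
rewrite ap ?bq //; first by rewrite (leq_ltn_trans (leq_subr _ _)).
by rewrite (leq_ltn_trans _ ltnN) // -ltnS.
Qed.

Lemma fps_agree_exp N a p i :
  fps_agree N a p -> fps_agree N (fps_exp a i) (p ^+ i).
Proof.
move=> ap; elim: i => [|i IHi]; first by rewrite expr0.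
by rewrite exprS; apply: fps_agree_mul.
Qed.

Lemma fps_agree_eval N (h : {poly {poly R}}) a p :
  fps_agree N a p -> fps_agree N (fps_eval h a) h.[p].
Proof.
move=> ap n ltnN; rewrite horner_coef coef_sum; apply: eq_bigr => i _.
apply: (fps_agree_mul (N := N)) => //; exact: fps_agree_exp.
Qed.

End Truncation.

Section Homogenization.

Variables (F : fieldType) (d : nat) (h : {poly {poly F}}).
Hypothesis hd : (size h <= d.+1)%N.

(** For [Q != 0] this is [Q ^+ d] times the value of [h] at [P / Q], kept inside [{poly F}]. *)
Definition homog (P Q : {poly F}) : {poly F} :=
  \sum_(i < d.+1) h`_i * P ^+ i * Q ^+ (d - i).

Lemma homog_neq0 P Q :
  (forall r : {fraction {poly F}}, ~~ root (map_poly (@tofrac {poly F}) h) r) ->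
  Q != 0 -> homog P Q != 0.
Proof.
move=> hroot Q0; apply/negP => /eqP K0.
have Qf0 : tofrac Q != 0 by rewrite tofrac_eq0.
have /negP[] := hroot (tofrac P / tofrac Q).
rewrite rootE (horner_coef_wide _ (n := d.+1)); last first.
  by rewrite (leq_trans (size_poly _ _)).
rewrite -(mulIr_eq0 _ (mulIf (expf_neq0 d Qf0))) -[X in _ == X]tofrac0 -K0.
rewrite rmorph_sum mulr_suml; apply/eqP; apply: eq_bigr => i _.
rewrite !rmorphM !rmorphXn coef_map /= exprMn exprVn.
have -> : tofrac Q ^+ d = tofrac Q ^+ i * tofrac Q ^+ (d - i).
  by rewrite -exprD subnKC // -ltnS.
by rewrite !mulrA mulfVK ?expf_neq0.
Qed.

(** Term [i] has degree at most [(m + i) + i * (L - 1) + (d - i) * L = d * L + m]: the excess [i]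
    allowed to [h_i] is absorbed by [deg P < L]. *)
Lemma size_homog (P Q : {poly F}) m L :
  (forall i, (i <= d)%N -> (size (h`_i)%R <= (m + i).+1)%N) ->
  (size P <= L)%N -> (size Q <= L.+1)%N ->
  (size (homog P Q) <= (d * L + m).+1)%N.
Proof.
move=> hm sP sQ; apply: (leq_trans (size_sum _ _ _)); apply/bigmax_leqP => i _.
have leid : (i <= d)%N by rewrite -ltnS.
(* A zero power is set apart because [sPi] can fail for it, as with [L = 0] and [i = 2]. *)
have [->|P0] := eqVneq (P ^+ i) 0; first by rewrite mulr0 mul0r size_poly0.
have sPi : (size (P ^+ i) + i <= (i * L).+1)%N.
  case: (posnP i) P0 => [->|i0]; first by rewrite expr0 size_poly1.
  rewrite expf_eq0 i0 /= -size_poly_gt0 => P0.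
  have : (((size P).-1 * i).+1 + i <= (i * L).+1)%N.
    by rewrite addSn ltnS -mulSnr prednK // mulnC leq_mul2l sP orbT.
  by apply: leq_trans; rewrite leq_add2r size_poly_exp_leq.
have sQi : (size (Q ^+ (d - i)) <= ((d - i) * L).+1)%N.
  rewrite (leq_trans (size_poly_exp_leq _ _)) // ltnS mulnC leq_mul2l.
  by rewrite -subn1 leq_subLR add1n sQ orbT.
have := hm i leid; have := size_polyMleq h`_i (P ^+ i).
have := size_polyMleq (h`_i * P ^+ i) (Q ^+ (d - i)).
have -> : (d * L = i * L + (d - i) * L)%N by rewrite -mulnDl subnKC.
move: sPi sQi; move: (size (P ^+ i)) (size (Q ^+ (d - i))) (size h`_i) => a b c.
move: (size (_ * P ^+ i)) (size (_ * Q ^+ (d - i))) => e f; lia.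
Qed.

(** Modulo [D], [P] is [Q * g], so [P ^+ i * Q ^+ (d - i)] is [Q ^+ d * g ^+ i], and the sum becomes
    [Q ^+ d * h.[g]]. *)
Lemma dvdp_homog (D g P Q : {poly F}) :
  D %| h.[g] -> D %| P - Q * g -> D %| homog P Q.
Proof.
move=> Dh DP.
have -> : homog P Q = (homog P Q - Q ^+ d * h.[g]) + Q ^+ d * h.[g].
  by rewrite subrK.
rewrite dvdp_add ?dvdp_mull // (horner_coef_wide _ hd) mulr_sumr -sumrB.
apply: (big_ind (fun p => D %| p)) => [|p q Dp Dq|i _].
- exact: dvdp0.
- exact: dvdp_add.
have -> : h`_i * P ^+ i * Q ^+ (d - i) - Q ^+ d * (h`_i * g ^+ i) =
          h`_i * Q ^+ (d - i) * (P ^+ i - (Q * g) ^+ i).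
  have {1}-> : Q ^+ d = Q ^+ i * Q ^+ (d - i).
    by rewrite -exprD subnKC // -ltnS.
  by rewrite exprMn; ring.
by rewrite dvdp_mull // subrXX dvdp_mulr.
Qed.

End Homogenization.

Section LinearRecurrences.

Variables (F : finFieldType) (u : nat -> F).

Lemma lin_rec_pade N L : lin_rec u N L ->
  exists P Q : {poly F}, [/\ (size P <= L)%N, (size Q <= L.+1)%N, Q != 0 &
    'X^N %| P - Q * \poly_(i < N) u i].
Proof.
case/existsP=> c /forallP cP; set g := \poly_(i < N) u i.
(* The reversed characteristic polynomial of the recurrence: for [L <= n < N], coefficient [n] of
   [Q * g] is the defect of the recurrence at [n - L], hence zero. *)
pose Q : {poly F} := 1 - \sum_(i < L) c i *: 'X^(L - i).
have Qn n : (L <= n)%N -> (Q * g)`_n = g`_n - \sum_(i < L) c i * g`_(n - L + i).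
  move=> leLn; rewrite mulrBl mul1r coefB mulr_suml coef_sum; congr (_ - _).
  apply: eq_bigr => i _; rewrite -scalerAl coefZ coefXnM ltnNge.
  rewrite (leq_trans (leq_subr i L) leLn) /= subnBA ?(ltnW (ltn_ord i)) //.
  by rewrite addnBAC.
exists (take_poly N (Q * g)), Q; split.
- apply/leq_sizeP => n leLn; rewrite coef_take_poly; case: ltnP => // ltnN.
  have ltn : (n - L < N - L)%N by rewrite ltn_sub2r ?(leq_ltn_trans leLn).
  have /eqP := cP (Ordinal ltn); rewrite /= subnK // => un.
  rewrite Qn // coef_poly ltnN un -sumrB big1 // => i _.
  have ltiN : (n - L + i < N)%N by have := ltn_ord i; lia.
  by rewrite coef_poly ltiN subrr.
- rewrite (leq_trans (size_polyD _ _)) // geq_max size_poly1 size_polyN /=.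
  apply: (leq_trans (size_sum _ _ _)); apply/bigmax_leqP => i _.
  by rewrite (leq_trans (size_scale_leq _ _)) // size_polyXn ltnS leq_subr.
- apply/eqP => /(congr1 (fun p : {poly F} => p`_0)) /eqP.
  rewrite coefB coef1 coef0 coef_sum big1 ?subr0 ?oner_eq0 // => i _.
  by rewrite coefZ coefXn eq_sym subn_eq0 leqNgt ltn_ord mulr0.
- rewrite -[X in _ - X](poly_take_drop N (Q * g)) opprD addrA subrr sub0r.
  by rewrite dvdpNr dvdp_mull.
Qed.

Lemma lin_rec_or_shorter N L :
  lin_rec u N L \/ exists2 m, (m < N - L)%N & lin_rec u (m + L) m.
Proof.
pose A : 'M[F]_(N - L, L) := \matrix_(j, i) u (j + i)%N.
have [/row_freeP[B AB]|] := boolP (row_free A).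
  left; pose c := B *m (\col_(j < N - L) u (j + L)%N).
  apply/existsP; exists [ffun i => c i 0]; apply/forallP => n; apply/eqP.
  have /matrixP/(_ n 0) : A *m c = \col_(j < N - L) u (j + L)%N.
    by rewrite mulmxA AB mul1mx.
  rewrite !mxE => <-; apply: eq_bigr => i _.
  by rewrite ffunE !mxE mulrC.
rewrite -kermx_eq0 => /rowV0Pn[v /sub_kermxP vA /rV0Pn[j0 vj0]]; right.
case: (arg_maxnP (P := fun j => v 0 j != 0) (fun j => j : nat) vj0) => m vm maxm.
(* [w] extends [v] to all naturals; the default [m] of [insubd] is never reached, as only indices
   below [N - L] occur. *)
pose w k := v 0 (insubd m k).
have wm : w m = v 0 m by rewrite /w valKd.
have w0 k : (m < k < N - L)%N -> w k = 0.
  case/andP=> ltmk ltk; apply: contraTeq ltmk => /maxm.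
  by rewrite -leqNgt /insubd insubT.
exists m => //; apply/existsP; exists [ffun i : 'I_m => - w i / w m].
apply/forallP => -[n ltn]; have ltnL := ltn; rewrite addKn in ltnL; apply/eqP => /=.
(* Column [n] of [v *m A = 0]; its terms beyond [m] vanish, and solving for the term at [m] gives
   the recurrence. *)
have : \sum_(0 <= k < N - L) w k * u (k + n)%N = 0.
  have /matrixP/(_ 0 (Ordinal ltnL)) := vA; rewrite !mxE => {2}<-.
  by rewrite big_mkord; apply: eq_bigr => j _; rewrite mxE /w valKd.
rewrite (big_cat_nat _ (n := m.+1)) //= [X in _ + X]big_nat.
rewrite [X in _ + X]big1 => [|k /w0 wk0]; last first.
  by rewrite wk0 mul0r.
rewrite addr0 big_nat_recr //= big_mkord addrC => /eqP.
rewrite addr_eq0 => /eqP wu.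
rewrite -wm in vm; apply: (mulfI vm); rewrite addnC wu mulr_sumr -sumrN.
by apply: eq_bigr => i _; rewrite ffunE addnC mulrA mulrCA divff // mulr1 mulNr.
Qed.

End LinearRecurrences.

(** Stated for every admissible [L], not only the least one, since the upper bound applies it to the
    shorter recurrence. *)
Lemma lin_rec_lower (F : finFieldType) (u : nat -> F) (d m : nat)
    (h : {poly {poly F}}) (N L : nat) :
  (size h <= d.+1)%N -> (forall n, fps_eval h (gen_fun u) n = 0) ->
  (forall r : {fraction {poly F}}, ~~ root (map_poly (@tofrac {poly F}) h) r) ->
  (forall i, (i <= d)%N -> (size (h`_i)%R <= (m + i).+1)%N) ->
  lin_rec u N L -> (N <= d * L + m)%N.
Proof.
move=> hd hG hroot hm /lin_rec_pade[P [Q [sP sQ Q0 PQ]]].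
set g := \poly_(i < N) u i in PQ.
have ug : fps_agree N (gen_fun u) g by move=> n ltnN; rewrite coef_poly ltnN.
have hg : 'X^N %| h.[g].
  rewrite -(poly_take_drop N h.[g]) dvdp_add ?dvdp_mull //.
  suff -> : take_poly N h.[g] = 0 by rewrite dvdp0.
  apply/polyP => n; rewrite coef_take_poly coef0; case: ltnP => // ltnN.
  by rewrite -(fps_agree_eval h ug) ?hG.
have /dvdp_leq := dvdp_homog hd hg PQ.
rewrite size_polyXn => /(_ (homog_neq0 hd P hroot Q0)) leN.
by rewrite -ltnS (leq_trans leN) // size_homog.
Qed.

Theorem theorem1 (q : nat) (F : finFieldType) (hq : #|F| = q)
    (u : nat -> F) (hauto : automatic q u) (hper : ~ ultimately_periodic u)
    (d : nat) (h : {poly {poly F}}) (hd : (size h <= d.+1)%N) (h0 : h != 0)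
    (hG : forall n : nat, fps_eval h (gen_fun u) n = 0)
    (hroot : forall r : {fraction {poly F}},
       ~~ root (map_poly (@tofrac {poly F}) h) r)
    (M : int) (hM : is_max_deg_sub h d M)
    (N : nat) (hN : (1 <= N)%N) :
  (N%:Z - M)%:~R / d%:R <= (lin_complexity u N)%:R :> rat /\
  (lin_complexity u N)%:R <= ((d%:Z - 1) * N%:Z + M + 1)%:~R / d%:R :> rat.
Proof.
(* Since 0 is not a root, [i = 0] contributes to the maximum, so [M] is a natural number [m]. *)
have h00 : h`_0 != 0.
  apply/negP => /eqP h00; have /negP[] := hroot 0.
  by rewrite rootE horner_coef0 coef_map h00 raddf0.
case: hM => _ hM.
have M0 : (0 <= M) by have := hM 0%N (leq0n d) h00; lia.
case: M M0 hM => // m _ hM.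
have hm i : (i <= d)%N -> (size (h`_i)%R <= (m + i).+1)%N.
  move=> leid; have [->|hi] := eqVneq h`_i 0; first by rewrite size_poly0.
  by have := hM i leid hi; move: (size h`_i) => s; lia.
have lower := lin_rec_lower hd hG hroot hm.
have lin_recT n l : (n <= l)%N -> lin_rec u n l.
  move=> lenl; apply/existsP; exists [ffun=> 0].
  by apply/forallP => -[j]; rewrite (eqP (_ : n - l == 0)%N) // subn_eq0.
(* With [d = 0] the lower bound would read [N <= m], yet [N = L = m + 1] satisfies the recurrence
   condition vacuously. *)
have d0 : (0 < d)%N.
  rewrite lt0n; apply/eqP => dd.
  by have := lower m.+1 m.+1 (lin_recT _ _ (leqnn _)); lia.
have dR : 0 < d%:R :> rat by rewrite ltr0n.
rewrite ler_pdivrMr // ler_pdivlMr //.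
rewrite -!natrM ![_%:R]pmulrn !ler_int.
rewrite /lin_complexity; case: ex_minnP => L recL minL; split.
  by have := lower _ _ recL; lia.
(* The least [L] with [d * L > (d - 1) * (N - 1) + m]; the upper bound follows as [(d - 1) * (N - 1)
   + m + d = (d - 1) * N + m + 1]. *)
pose L' := (((d - 1) * (N - 1) + m) %/ d).+1.
have leL' : (L' * d <= (d - 1) * (N - 1) + m + d)%N.
  by rewrite mulSn addnC leq_add2r leq_trunc_div.
have ltL' : ((d - 1) * (N - 1) + m < L' * d)%N by rewrite ltn_ceil.
suff : (L <= L')%N by nia.
apply: minL.
(* A shorter recurrence gives [L' <= (d - 1) * k + m] with [k <= N - L' - 1], so
   [d * L' <= (d - 1) * (N - 1) + m], against [ltL']. *)
case: (lin_rec_or_shorter u N L') => // -[k ltk /lower]; nia.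
Qed.
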